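(* A Noetherian local ring $R$ is analytically unramified if and only if there exists a (unary) numerical function $\nu_R$ such that for every $x\in R$ we have an inequality $$\operatorname{ord}(x^2)\leq\nu_R(\operatorname{ord}(x)).$$
   Context: A Noetherian local ring is analytically unramified if its completion is reduced. For $x$ in a local ring $(R,\mathfrak m)$, the order $\operatorname{ord}(x)$ is the supremum (possibly $\infty$) of all $n$ with $x\in\mathfrak m^n$. A unary numerical function is a non-decreasing map $f\colon\mathbb N\cup\{\infty\}\to\mathbb N\cup\{\infty\}$ such that $f(s)=\infty$ if and only if $s=\infty$. *)

(* Defs.v *)
From HB Require Import structures.
From mathcomp Require Import all_boot all_order all_algebra.
From mathcomp Require Import generic_quotient ring_quotient.
From mathcomp Require Import boolp classical_sets functions.

Set Implicit Arguments.
Unset Strict Implicit.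
Unset Printing Implicit Defensive.

Import Order.TTheory GRing.Theory.

Local Open Scope classical_set_scope.
Local Open Scope ring_scope.
Local Open Scope quotient_scope.

Variant natbar : Type := Fin of nat | Infty.

Definition natbar_opt (s : natbar) : option nat :=
  if s is Fin n then Some n else None.
Definition opt_natbar (o : option nat) : natbar :=
  if o is Some n then Fin n else Infty.

Fact natbar_optK : cancel natbar_opt opt_natbar.
Proof. by case. Qed.

HB.instance Definition _ := Choice.copy natbar (can_type natbar_optK).

Definition natbar_le (s t : natbar) : bool :=
  match s, t with
  | _, Infty => true
  | Infty, Fin _ => false
  | Fin a, Fin b => (a <= b)%N
  end.

Fact natbar_display : Order.disp_t. Proof. exact: Order.Disp tt tt. Qed.

Fact natbar_le_refl : reflexive natbar_le.
Proof. by case=> [a|] //=. Qed.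

Fact natbar_le_anti : antisymmetric natbar_le.
Proof. by case=> [a|] [b|] //= ab; congr Fin; apply/eqP; rewrite eqn_leq. Qed.

Fact natbar_le_trans : transitive natbar_le.
Proof. by case=> [a|] [b|] [c|] //=; apply: leq_trans. Qed.

Fact natbar_le_total : total natbar_le.
Proof. by case=> [a|] [b|] //=; apply: leq_total. Qed.

HB.instance Definition _ := @Order.Le_isPOrder.Build natbar_display natbar
  natbar_le natbar_le_refl natbar_le_anti natbar_le_trans.
HB.instance Definition _ :=
  @Order.POrder_isTotal.Build natbar_display natbar natbar_le_total.

Definition numerical_function (f : natbar -> natbar) : Prop :=
  {homo f : s t / (s <= t)%O} /\ forall s, f s = Infty <-> s = Infty.

(* Unlike those of [ring_quotient], ideals here need not be proper: the powers
   of an ideal start with the unit ideal. *)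

Section Ideals.
Variable R : comPzRingType.
Implicit Types (I J m A : set R) (x y : R).

Definition is_ideal I : Prop :=
  [/\ I 0, forall x y, I x -> I y -> I (x + y) & forall a x, I x -> I (a * x)].

Definition ideal_span A : set R := smallest is_ideal A.

Definition ideal_mul I J : set R :=
  ideal_span [set x * y | x in I & y in J].

Definition ideal_pow I n : set R := iter n (ideal_mul I) setT.

Definition maximal_ideal m : Prop :=
  [/\ is_ideal m, m <> setT &
    forall J, is_ideal J -> m `<=` J -> J = m \/ J = setT].

Definition local_ring m : Prop :=
  maximal_ideal m /\ forall m', maximal_ideal m' -> m' = m.

Lemma ideal_span_ideal A : is_ideal (ideal_span A).
Proof.
split=> [I [[]]//|x y Ax Ay I [Ii AI]|a x Ax I [Ii AI]].
- by case: (Ii) => _ D _; apply: D; [apply: Ax|apply: Ay].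
- by case: (Ii) => _ _ M; apply: M; apply: Ax.
Qed.

Lemma ideal_pow_ideal I n : is_ideal (ideal_pow I n).
Proof. by case: n => [|n]; [split|apply: ideal_span_ideal]. Qed.

Lemma ideal_pow_le I a b : (a <= b)%N -> ideal_pow I b `<=` ideal_pow I a.
Proof.
move=> /subnK <-; elim: (b - a)%N => // k IHk; apply: subset_trans IHk.
rewrite addSn /=; apply: smallest_sub; first exact: ideal_pow_ideal.
by move=> _ [x _ [y Iy <-]]; case: (ideal_pow_ideal I (k + a)) => _ _; apply.
Qed.

Definition ord m x : natbar :=
  supremum (Fin 0%N) [set Fin n | n in [set n | ideal_pow m n x]].

Lemma le_ord m x n : (Fin n <= ord m x)%O <-> ideal_pow m n x.
Proof.
rewrite /ord; set S := (X in supremum _ X).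
have S0 : S (Fin 0) by exists 0%N.
have supE s : supremums S s -> supremum (Fin 0) S = s.
  move=> Ss; rewrite /supremum ifF; last first.
    by apply/negP => /eqP SE; rewrite SE in S0.
  by apply: xget_subset1 => //; apply: is_subset1_supremums.
have [allx|/existsNP[n0 n0x]] := pselect (forall n, ideal_pow m n x).
  rewrite (supE Infty) //; split; first by move=> [].
  case=> [a|//] /(_ (Fin a.+1)) h; exfalso.
  have Sa : S (Fin a.+1) by exists a.+1 => //; apply: allx.
  by have := h Sa; rewrite -[(_ <= _)%O]/(a.+1 <= a)%N ltnn.
have ubS k : `[< ideal_pow m k x >] -> (k <= n0)%N.
  move=> /asboolP kx; rewrite leqNgt; apply/negP => /ltnW lt.
  by apply: n0x; apply: ideal_pow_le lt _ kx.
have exS : exists k, `[< ideal_pow m k x >] by exists 0%N; apply/asboolP.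
case: (ex_maxnP exS ubS) => k /asboolP kx kmax.
rewrite (supE (Fin k)).
  split=> [nk|nx]; first exact: (ideal_pow_le nk).
  by apply: kmax; apply/asboolP.
split; first by move=> _ [j jx <-]; apply: kmax; apply/asboolP.
by move=> t; apply; exists k.
Qed.

End Ideals.

Definition noetherian (R : comPzRingType) : Prop :=
  forall I : set R, is_ideal I -> exists s : seq R, I = ideal_span [set` s].

Definition reduced (S : pzRingType) : Prop :=
  forall (x : S) n, x ^+ n = 0 -> x = 0.

Section Completion.
Variables (R : comPzRingType) (I : set R).
Implicit Types u v : nat -> R.

Let I0 n : ideal_pow I n 0. Proof. by case: (ideal_pow_ideal I n). Qed.
Let ID n x y : ideal_pow I n x -> ideal_pow I n y -> ideal_pow I n (x + y).
Proof. by case: (ideal_pow_ideal I n) => _ + _; apply. Qed.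
Let IM n a x : ideal_pow I n x -> ideal_pow I n (a * x).
Proof. by case: (ideal_pow_ideal I n) => _ _; apply. Qed.
Let IN n x : ideal_pow I n x -> ideal_pow I n (- x).
Proof. by rewrite -mulN1r; apply: IM. Qed.

Definition adic_cauchy : {pred nat -> R} := fun u =>
  `[< forall n, exists N, forall i j,
        (N <= i)%N -> (N <= j)%N -> ideal_pow I n (u i - u j) >].

Fact adic_cauchy_closed : subring_closed adic_cauchy.
Proof.
split.
- apply/asboolP => n; exists 0%N => i j _ _.
  by rewrite subrr; apply: I0.
- move=> u v /asboolP cu /asboolP cv; apply/asboolP => n.
  have [N uN] := cu n; have [M vM] := cv n.
  exists (maxn N M) => i j; rewrite !geq_max => /andP[Ni Mi] /andP[Nj Mj].
  have -> : (u - v) i - (u - v) j = (u i - u j) - (v i - v j).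
    by rewrite -[LHS]/(u i - v i - (u j - v j)) !opprD [LHS]addrACA.
  by apply: ID; [apply: uN|apply/IN/vM].
- move=> u v /asboolP cu /asboolP cv; apply/asboolP => n.
  have [N uN] := cu n; have [M vM] := cv n.
  exists (maxn N M) => i j; rewrite !geq_max => /andP[Ni Mi] /andP[Nj Mj].
  have -> : (u * v) i - (u * v) j = u i * (v i - v j) + v j * (u i - u j).
    rewrite -[LHS]/(u i * v i - u j * v j).
    by rewrite !mulrBr addrA (mulrC (v j) (u i)) subrK (mulrC (v j)).
  by apply: ID; apply: IM; [apply: vM|apply: uN].
Qed.

Definition cauchy_seq : Type := {u : nat -> R | adic_cauchy u}.

HB.instance Definition _ := SubChoice.on cauchy_seq.
HB.instance Definition _ :=
  GRing.SubChoice_isSubComPzRing.Build (nat -> R) adic_cauchy cauchy_seq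
    adic_cauchy_closed.

Definition adic_null : {pred cauchy_seq} := fun s =>
  `[< forall n, exists N, forall i, (N <= i)%N -> ideal_pow I n (val s i) >].

Fact adic_null_closed : zmod_closed adic_null.
Proof.
split; first by apply/asboolP => n; exists 0%N => i _; apply: I0.
move=> u v /asboolP cu /asboolP cv; apply/asboolP => n.
have [N uN] := cu n; have [M vM] := cv n.
exists (maxn N M) => i; rewrite geq_max => /andP[Ni Mi].
by rewrite rmorphB /=; apply: ID; [apply: uN|apply/IN/vM].
Qed.

HB.instance Definition _ :=
  GRing.isZmodClosed.Build cauchy_seq adic_null adic_null_closed.

Fact adic_null_mull (a u : cauchy_seq) : u \in adic_null -> a * u \in adic_null.
Proof.
move=> /asboolP cu; apply/asboolP => n; have [N uN] := cu n.
by exists N => i Ni; rewrite rmorphM /=; apply: IM; apply: uN.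
Qed.

(* Cauchy sequences modulo null sequences, for the [I]-adic topology.
   [ring_quotient] makes the quotient by a proper ideal a ring; [adic_null] is
   only known to be proper under hypotheses on [I], so the product is defined
   here and the result is a possibly trivial ring. *)
Definition completion : Type := Quotient.quot adic_null.

HB.instance Definition _ := Choice.on completion.
HB.instance Definition _ := EqQuotient.on completion.
HB.instance Definition _ := GRing.Zmodule.on completion.

Definition completion_one : completion := lift_cst completion 1.
Definition completion_mul := lift_op2 completion *%R.

Fact pi_completion_mul :
  {morph \pi_completion : x y / x * y >-> completion_mul x y}.
Proof.
move=> x y; unlock completion_mul; apply/eqP; rewrite piE Quotient.equivE.
set y' := repr (\pi_completion y); set x' := repr (\pi_completion x).
have -> : x * y - x' * y' = x * (y - y') + y' * (x - x').
  by rewrite !mulrBr addrA (mulrC y') subrK (mulrC y').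
by rewrite rpredD // adic_null_mull // Quotient.idealrBE reprK.
Qed.

Canonical pi_completion_one_morph := PiConst completion_one.
Canonical pi_completion_mul_morph := PiMorph2 pi_completion_mul.

Fact completion_mulA : associative completion_mul.
Proof. by move=> x y z; rewrite -[x]reprK -[y]reprK -[z]reprK !piE mulrA. Qed.

Fact completion_mulC : commutative completion_mul.
Proof. by move=> x y; rewrite -[x]reprK -[y]reprK !piE mulrC. Qed.

Fact completion_mul1 : left_id completion_one completion_mul.
Proof. by move=> x; rewrite -[x]reprK !piE mul1r. Qed.

Fact completion_mulDl : left_distributive completion_mul +%R.
Proof.
move=> x y z; rewrite -[x]reprK -[y]reprK -[z]reprK.
by apply/eqP; rewrite piE /= mulrDl Quotient.equivE subrr rpred0.
Qed.

HB.instance Definition _ := GRing.Zmodule_isComPzRing.Build completion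
  completion_mulA completion_mulC completion_mul1 completion_mulDl.

End Completion.

Definition analytically_unramified (R : comPzRingType) (m : set R) : Prop :=
  reduced (completion m).

(* Main.v *)
(* If nu bounds the order of squares, a Cauchy sequence whose squares tend to 0
   tends to 0, so the completion has no nonzero nilpotents.

   Conversely, let J_k be the ideal generated by A_k = {x | x^2 in m^k}, and
   suppose that no A_k is contained in m^n. Comparing initial monomials in
   generators of m, Dickson's lemma gives an r, independent of n, such that for
   k large J_k is generated by r elements modulo m^n; the exchange lemma picks
   these r elements in A_k. A product of r + 1 of them contains a square, hence
   z^(r+1) lies in m^n for every z in J_k. Comparing initial monomials also shows
   that the chain J_k is stationary modulo each power of m, so an element of A_k
   outside m^n can be corrected, modulo higher and higher powers of m, to a
   Cauchy sequence u_i with u_i in J_(k_i) and k_i unbounded. Its limit in the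
   completion is nonzero, and its (r+1)-st power is 0. *)
Require Import Defs.
From mathcomp Require Import all_boot all_order all_algebra.
From mathcomp Require Import generic_quotient ring_quotient.
From mathcomp Require Import boolp classical_sets.
From mathcomp Require Import zify.

Import Order.TTheory Order.DefaultSeqLexiOrder GRing.Theory.

Set Implicit Arguments.
Unset Strict Implicit.
Unset Printing Implicit Defensive.

Local Open Scope ring_scope.

(** * Exponent vectors: lexicographic order and Dickson's lemma *)

Section Exponents.
Implicit Types a b c : seq nat.
Local Open Scope classical_set_scope.

Fixpoint exp_add a b : seq nat :=
  if a is i :: a' then if b is j :: b' then (i + j)%N :: exp_add a' b' else [::]
  else [::].

Lemma size_exp_add a b : size a = size b -> size (exp_add a b) = size a.
Proof. by elim: a b => [|i a IHa] [|j b] //= [] /IHa ->. Qed.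

Lemma sumn_exp_add a b :
  size a = size b -> sumn (exp_add a b) = (sumn a + sumn b)%N.
Proof. by elim: a b => [|i a IHa] [|j b] //= [] /IHa ->; rewrite addnACA. Qed.

(** Translation invariance makes the lexicographic order compatible with multiplication by a
    monomial. *)
Lemma exp_addr_lt a b c : size a = size b -> size a = size c ->
  (a < b)%O -> (exp_add c a < exp_add c b)%O.
Proof.
elim: a b c => [|i a IHa] [|j b] [|k c] //= [ab] [ac].
rewrite !ltxi_cons !leEnat !leq_add2l.
by move=> /andP[-> /implyP h]; apply/implyP=> /h; apply: IHa.
Qed.

Fixpoint exps d s : seq (seq nat) :=
  if d is d'.+1 then
    flatten [seq [seq i :: b | b <- exps d' (s - i)%N] | i <- iota 0 s.+1]
  else if s is 0 then [:: [::]] else [::].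

Lemma mem_exps d s b : (b \in exps d s) = (size b == d) && (sumn b == s).
Proof.
elim: d s b => [|d IHd] s b; first by case: s => [|s]; case: b.
apply/(@flatten_mapP _ _ _ (iota 0 s.+1))/andP => [[i]|].
  rewrite mem_iota add0n ltnS => /andP[_ is_] /mapP[c].
  by rewrite IHd => /andP[/eqP <- /eqP cs] ->; rewrite /= cs subnKC.
case: b => [|i b] [] // /eqP[bd] /eqP bs.
rewrite /= in bs.
exists i; first by rewrite mem_iota; lia.
by apply/mapP; exists b; rewrite // IHd bd eqxx /=; apply/eqP; lia.
Qed.

(** Induction on [d], slicing by the first coordinate. A finite basis of the union of all slices
    settles the vectors with first coordinate at least [M]; each of the finitely many smaller values
    gets a basis of its own slice. *)
Lemma dickson d (U : set (seq nat)) : exists2 B : seq (seq nat),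
  (forall b, b \in B -> U b /\ size b = d) &
  forall a, U a -> size a = d ->
    exists2 b, b \in B & exists2 c, size c = d & a = exp_add c b.
Proof.
elim: d U => [|d IHd] U.
  have [U0|U0] := pselect (U [::]).
    exists [:: [::]] => [b|[|//] _ _]; first by rewrite inE => /eqP ->.
    by exists [::]; rewrite ?inE //; exists [::].
  by exists [::] => // -[|//] /U0.
pose slice i : set (seq nat) := [set b | U (i :: b)].
have [B BU BP] := IHd [set b | exists i, slice i b].
have /choice[f fP] b : exists i, b \in B -> slice i b.
  case: (boolP (b \in B)) => [bB|_]; last by exists 0%N.
  by have [[i ib] _] := BU b bB; exists i.
have /choice[g gP] : forall i, exists C : seq (seq nat),
    (forall b, b \in C -> slice i b /\ size b = d) /\
    (forall a, slice i a -> size a = d ->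
      exists2 b, b \in C & exists2 c, size c = d & a = exp_add c b).
  by move=> i; have [C ? ?] := IHd (slice i); exists C.
pose M := (\max_(b <- B) f b)%N.
exists ([seq f b :: b | b <- B] ++
        flatten [seq [seq i :: b | b <- g i] | i <- iota 0 M]).
  move=> b; rewrite mem_cat => /orP[/mapP[c cB ->]|].
    by split; [apply: fP|rewrite /= (BU c cB).2].
  case/flatten_mapP => i _ /mapP[c ci ->].
  by have [h cd] := (gP i).1 c ci; rewrite /= cd.
move=> [|i a] // Uia [ad].
have [iM|Mi] := ltnP i M.
  have [b bg [c cd ac]] := (gP i).2 a Uia ad.
  exists (i :: b).
    rewrite mem_cat; apply/orP; right; apply/flatten_mapP.
    by exists i; rewrite ?mem_iota // map_f.
  by exists (0%N :: c); rewrite /= ?cd // ac.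
have [b bB [c cd ac]] := BP a (ex_intro _ i Uia) ad.
exists (f b :: b); first by rewrite mem_cat map_f.
exists ((i - f b)%N :: c); rewrite /= ?cd // ac subnK //.
by apply: leq_trans Mi; rewrite /M (leq_bigmax_seq _ bB).
Qed.

(** Each of the finitely many [x] either satisfies [P] at every index or fails from some index on;
    [K] is the maximum of the latter indices. *)
Lemma eventually_stable (T : eqType) (t : seq T) (P : nat -> T -> Prop) :
  (forall k l x, (k <= l)%N -> P l x -> P k x) ->
  exists K, forall k, (K <= k)%N -> forall x, x \in t -> P k x ->
    forall l, P l x.
Proof.
move=> Pd; elim: t => [|y t [K HK]]; first by exists 0%N.
have [Py|/existsNP[l Nl]] := pselect (forall l, P l y).
  by exists K => k /HK h x; rewrite inE => /orP[/eqP ->|/h].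
exists (maxn K l) => k; rewrite geq_max => /andP[/HK h lk] x.
by rewrite inE => /orP[/eqP -> /(Pd _ _ _ lk)//|/h].
Qed.

End Exponents.

(** * Sums of ideals, adjoined generators and powers *)

Section Ideals.
Variable R : comPzRingType.
Implicit Types (I J N : set R) (x y z c : R) (s : seq R).
Local Open Scope classical_set_scope.

Lemma is_ideal0 I : is_ideal I -> I 0. Proof. by case. Qed.
Lemma is_idealD I x y : is_ideal I -> I x -> I y -> I (x + y).
Proof. by case=> _ + _; apply. Qed.
Lemma is_idealM I c x : is_ideal I -> I x -> I (c * x).
Proof. by case=> _ _; apply. Qed.
Lemma is_idealMr I x c : is_ideal I -> I x -> I (x * c).
Proof. by move=> ? ?; rewrite mulrC; apply: is_idealM. Qed.
Lemma is_idealN I x : is_ideal I -> I x -> I (- x).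
Proof. by move=> ? ?; rewrite -mulN1r; apply: is_idealM. Qed.
Lemma is_idealB I x y : is_ideal I -> I x -> I y -> I (x - y).
Proof. by move=> ? ? ?; apply: is_idealD => //; apply: is_idealN. Qed.

Lemma is_ideal_sum I n (F : 'I_n -> R) :
  is_ideal I -> (forall i, I (F i)) -> I (\sum_(i < n) F i).
Proof.
move=> Ii FI; apply: big_ind => // [|x y]; first exact: is_ideal0.
exact: is_idealD.
Qed.

Lemma is_ideal_setI I J : is_ideal I -> is_ideal J -> is_ideal (I `&` J).
Proof.
move=> Ii Ji; split=> [|x y [Ix Jx] [Iy Jy]|c x [Ix Jx]].
- by split; exact: is_ideal0.
- by split; exact: is_idealD.
- by split; exact: is_idealM.
Qed.

Definition ideal_add I J : set R := [set z | exists2 y, I y & J (z - y)].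

Lemma is_ideal_add I J : is_ideal I -> is_ideal J -> is_ideal (ideal_add I J).
Proof.
move=> Ii Ji; split.
- by exists 0; rewrite ?subr0; exact: is_ideal0.
- move=> x y [x' Ix Jx] [y' Iy Jy]; exists (x' + y'); first exact: is_idealD.
  by rewrite opprD addrACA; exact: is_idealD.
- move=> c x [x' Ix Jx]; exists (c * x'); first exact: is_idealM.
  by rewrite -mulrBr; exact: is_idealM.
Qed.

(** The ideal [I + (x)]. Iterated as [foldr adjoin N s] it is the ideal generated by [s] modulo [N],
    in a form that releases one generator and its coefficient at a time. *)
Definition adjoin x I : set R := [set z | exists c, I (z - c * x)].

Lemma is_ideal_adjoin x I : is_ideal I -> is_ideal (adjoin x I).
Proof.
move=> Ii; split.
- by exists 0; rewrite mul0r subr0; exact: is_ideal0.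
- move=> y z [c Iy] [d Iz]; exists (c + d).
  rewrite mulrDl opprD addrACA; exact: is_idealD.
- move=> c y [d Iy]; exists (c * d); rewrite -mulrA -mulrBr; exact: is_idealM.
Qed.

Lemma sub_adjoin x I : I `<=` adjoin x I.
Proof. by move=> y Iy; exists 0; rewrite mul0r subr0. Qed.

Lemma adjoin_mem x I : is_ideal I -> adjoin x I x.
Proof. by move=> Ii; exists 1; rewrite mul1r subrr; exact: is_ideal0. Qed.

Lemma adjoin_sub x I J : is_ideal J -> I `<=` J -> J x -> adjoin x I `<=` J.
Proof.
move=> Ji IJ Jx z [c /IJ Jz]; rewrite -(subrK (c * x) z).
by apply: is_idealD => //; exact: is_idealM.
Qed.

Lemma is_ideal_adjoins N s : is_ideal N -> is_ideal (foldr adjoin N s).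
Proof. by move=> Ni; elim: s => //= x s; exact: is_ideal_adjoin. Qed.

Lemma sub_adjoins N s : N `<=` foldr adjoin N s.
Proof. by elim: s => //= x s IHs y /IHs; exact: sub_adjoin. Qed.

Lemma adjoins_mem N s x : is_ideal N -> x \in s -> foldr adjoin N s x.
Proof.
move=> Ni; elim: s => //= y s IHs; rewrite inE => /orP[/eqP ->|/IHs].
  by apply: adjoin_mem; exact: is_ideal_adjoins.
exact: sub_adjoin.
Qed.

Lemma adjoins_sub N s J : is_ideal J -> N `<=` J ->
  (forall x, x \in s -> J x) -> foldr adjoin N s `<=` J.
Proof.
move=> Ji NJ; elim: s => //= x s IHs sJ; apply: adjoin_sub => //.
  by apply: IHs => y ys; apply: sJ; rewrite inE ys orbT.
by apply: sJ; rewrite mem_head.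
Qed.

Lemma ideal_span_sub I (A : set R) : is_ideal I -> A `<=` I ->
  ideal_span A `<=` I.
Proof. exact: smallest_sub. Qed.

Lemma ideal_span_mem (A : set R) x : A x -> ideal_span A x.
Proof. by move=> Ax; apply: sub_gen_smallest. Qed.

Lemma is_ideal_colon x I : is_ideal I -> is_ideal [set z | I (x * z)].
Proof.
move=> Ii; split=> [|y z Iy Iz|c y Iy] /=.
- by rewrite mulr0; exact: is_ideal0.
- by rewrite mulrDr; exact: is_idealD.
- by rewrite mulrCA; exact: is_idealM.
Qed.

Lemma ideal_span_mul (A B I : set R) : is_ideal I ->
  (forall x y, A x -> B y -> I (x * y)) ->
  forall x y, ideal_span A x -> ideal_span B y -> I (x * y).
Proof.
move=> Ii AB x y Ax By.
suff: ideal_span A `<=` [set x | I (y * x)] by move=> /(_ x Ax); rewrite /= mulrC.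
apply: ideal_span_sub; first exact: is_ideal_colon.
move=> z Az /=; rewrite mulrC.
suff: ideal_span B `<=` [set y | I (z * y)] by apply.
by apply: ideal_span_sub; [exact: is_ideal_colon|move=> t /(AB _ _ Az)].
Qed.

Lemma ideal_powM I i j x y :
  ideal_pow I i x -> ideal_pow I j y -> ideal_pow I (i + j) (x * y).
Proof.
elim: i x => [|i IHi] x.
  by move=> _ Iy; apply: is_idealM => //; exact: ideal_pow_ideal.
rewrite addSn /= => Ix Iy.
suff: ideal_pow I i.+1 `<=` [set x | ideal_pow I (i + j).+1 (y * x)].
  by move=> /(_ x Ix) /=; rewrite mulrC.
apply: ideal_span_sub; first by apply: is_ideal_colon; exact: ideal_span_ideal.
move=> _ [u Iu [v Iv <-]] /=; rewrite mulrC -mulrA; apply: ideal_span_mem.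
by exists u => //; exists (v * y) => //; exact: IHi.
Qed.

Lemma ideal_pow1 I x : I x -> ideal_pow I 1 x.
Proof. by move=> Ix; apply: ideal_span_mem; exists x => //; exists 1; rewrite ?mulr1. Qed.

Lemma ideal_pow_exp I x n : I x -> ideal_pow I n (x ^+ n).
Proof.
move=> Ix; elim: n => // n IHn; rewrite exprS -add1n.
by apply: ideal_powM => //; exact: ideal_pow1.
Qed.

(** Every term of the binomial expansion contains [y ^+ t] or at least two factors [x]. *)
Lemma ideal_exprD N x y t : is_ideal N -> N (x ^+ 2) -> N (y ^+ t) ->
  N ((x + y) ^+ t.+1).
Proof.
move=> Ni Nx Ny; rewrite exprDn; apply: is_ideal_sum => // -[i /= it].
rewrite -mulr_natl; apply: is_idealM => //.
have [ti|ti] := leqP t i.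
  by apply: is_idealM => //; rewrite -(subnK ti) exprD; exact: is_idealM.
apply: is_idealMr => //.
have -> : (t.+1 - i = (t.+1 - i - 2) + 2)%N by lia.
by rewrite exprD; exact: is_idealM.
Qed.

(* By pigeonhole: a monomial of degree [size s + 1] in the elements of [s]
   contains a square. *)
Lemma adjoins_expr N s z : is_ideal N -> (forall x, x \in s -> N (x ^+ 2)) ->
  foldr adjoin N s z -> N (z ^+ (size s).+1).
Proof.
move=> Ni; elim: s z => [|x s IHs] z sN /=; first by rewrite expr1.
case=> c zN; rewrite -(subrKC (c * x) z); apply: ideal_exprD => //.
  by rewrite exprMn; apply: is_idealM => //; apply: sN; rewrite mem_head.
by apply: IHs => // y ys; apply: sN; rewrite inE ys orbT.
Qed.

Lemma adjoinC N x y : adjoin x (adjoin y N) `<=` adjoin y (adjoin x N).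
Proof. by move=> z [c [d h]]; exists d, c; rewrite addrAC. Qed.

Lemma adjoin_subset x I J : I `<=` J -> adjoin x I `<=` adjoin x J.
Proof. by move=> IJ z [c /IJ h]; exists c. Qed.

Lemma adjoinsC N x s :
  foldr adjoin (adjoin x N) s `<=` adjoin x (foldr adjoin N s).
Proof.
elim: s => //= y s IHs; apply: subset_trans (@adjoinC _ _ _).
exact: adjoin_subset.
Qed.

Lemma adjoins_adjoin N x s :
  adjoin x (foldr adjoin N s) `<=` foldr adjoin (adjoin x N) s.
Proof.
elim: s => //= y s IHs; apply: subset_trans (@adjoinC _ _ _) _.
exact: adjoin_subset.
Qed.

End Ideals.

(** * Local rings: units and exchange of generators *)

Section LocalRing.
Variables (R : comPzRingType) (m : set R).
Local Open Scope classical_set_scope.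

Lemma maximal_ideal_exists (c : R) : (forall d, d * c <> 1) ->
  exists2 I, maximal_ideal I & I c.
Proof.
move=> c_nonunit.
pose P (I : set R) := I = set0 \/ [/\ is_ideal I, I c & ~ I 1].
have [|I [PI Imax]] := @Zorn_bigcup R P.
  move=> F FP Ftot; have [F0|] := pselect (forall I, F I -> I = set0).
    by left; apply: bigcup0.
  move=> /existsNP[I /not_implyP[FI I0]]; right.
  have Fi J : F J -> J !=set0 -> [/\ is_ideal J, J c & ~ J 1].
    by move=> /FP[->[]//|].
  have [|Ii Ic I1] := Fi I FI; first by apply/set0P/eqP.
  split; last 2 first.
  - by exists I.
  - by move=> [J FJ J1]; have [] := Fi J FJ (ex_intro _ _ J1).
  split.
  - by exists I => //; exact: is_ideal0.
  - move=> x y [J FJ Jx] [K FK Ky].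
    have [Ji _ _] := Fi J FJ (ex_intro _ _ Jx).
    have [Ki _ _] := Fi K FK (ex_intro _ _ Ky).
    case: (Ftot J K FJ FK) => [/(_ _ Jx)|/(_ _ Ky)] h.
      by exists K => //; exact: is_idealD.
    by exists J => //; exact: is_idealD.
  - move=> a x [J FJ Jx]; have [Ji _ _] := Fi J FJ (ex_intro _ _ Jx).
    by exists J => //; exact: is_idealM.
have [I0|[Ii Ic I1]] := PI.
  have [] := Imax (adjoin c [set 0]).
    rewrite I0; split; first exact: sub0set.
    by move=> /(_ 0); apply; exists 0; rewrite mul0r subr0.
  have N0 : is_ideal [set 0 : R].
    by split=> // [x y -> ->|a x ->]; rewrite ?addr0 ?mulr0.
  right; split; first exact: is_ideal_adjoin.
    exact: adjoin_mem.
  by move=> [d /= /eqP]; rewrite subr_eq0 eq_sym => /eqP /c_nonunit.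
exists I => //; split=> // [IT|J Ji IJ]; first by apply: I1; rewrite IT.
have [JI|JI] := pselect (J `<=` I); [left|right].
  by apply/seteqP; split.
have [J1|J1] := pselect (J 1).
  by apply/seteqP; split=> // x _; rewrite -(mulr1 x); exact: is_idealM.
have [] := Imax J; first by split.
by right; split=> //; apply: IJ.
Qed.

Hypothesis m_local : local_ring m.

Lemma local_ring_ideal : is_ideal m. Proof. by case: m_local => -[]. Qed.

Lemma local_ring_unit (c : R) : ~ m c -> exists d, d * c = 1.
Proof.
apply: contra_notP => /forallNP c_nonunit.
have [I Imax Ic] := maximal_ideal_exists c_nonunit.
by rewrite -(m_local.2 I Imax).
Qed.

Lemma local_ring_unit1B (c : R) : m c -> exists d, d * (1 - c) = 1.
Proof.
move=> mc; apply: local_ring_unit => m1c.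
have mi := local_ring_ideal; have [[_ mT _] _] := m_local; apply: mT.
have m1 : m 1 by rewrite -(subrK c 1); exact: is_idealD.
by apply/seteqP; split=> // x _; rewrite -(mulr1 x); exact: is_idealM.
Qed.

(** Steinitz exchange modulo [N], one generator [y] of [s] at a time. If some element of [A] has a
    unit coefficient at [y] modulo the other generators, it replaces [y]; otherwise [y] is redundant
    by Nakayama, and [0] fills its place to keep the length. *)
Lemma adjoins_exchange (A N : set R) (s : seq R) : is_ideal N -> A 0 ->
  (forall y, y \in s -> ideal_span A y) ->
  ideal_span A `<=` foldr (@adjoin R) N s ->
  exists t, [/\ size t = size s, forall x, x \in t -> A x &
    ideal_span A `<=` foldr (@adjoin R) N t].
Proof.
have mi := local_ring_ideal.
elim: s N => [|y s IHs] N Ni A0 sA AN; first by exists [::].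
have N1i := is_ideal_adjoins s Ni; set N1 := foldr _ _ _ in N1i.
have Ay : ideal_span A y by apply: sA; rewrite mem_head.
have [x Ax AxN1] : exists2 x, A x & ideal_span A `<=` adjoin x N1.
  have [[x [Ax [c [Nx mc]]]]|noA] :=
    pselect (exists x, A x /\ exists c, N1 (x - c * y) /\ ~ m c).
    exists x => //; have [d dc] := local_ring_unit mc.
    apply: subset_trans AN _; apply: adjoin_sub.
    - exact: is_ideal_adjoin.
    - exact: sub_adjoin.
    - exists d.
      have -> : y - d * x = - d * (x - c * y).
        by rewrite mulrBr mulrA !mulNr dc mul1r opprK addrC.
      exact: is_idealM.
  exists 0 => //; suff Ny : N1 y.
    apply: subset_trans AN _; apply: subset_trans (@sub_adjoin R 0 N1).
    exact: adjoin_sub.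
  (* Without unit coefficients these [z] form an ideal containing [A], hence [y]. So [(1 - c) * y]
     lies in [N1], with [1 - c] a unit. *)
  have [c mc Nyc] : [set z | exists2 c, m c & N1 (z - c * y)] y.
    apply: ideal_span_sub Ay; last first.
      move=> x Ax; have [c Nx] := AN x (ideal_span_mem Ax).
      exists c => //; apply: contrapT => mc.
      by apply: noA; exists x; split=> //; exists c.
    split.
    - by exists 0; rewrite ?mul0r ?subr0; exact: is_ideal0.
    - move=> u v [c mc Nu] [d md Nv]; exists (c + d); first exact: is_idealD.
      by rewrite mulrDl opprD addrACA; exact: is_idealD.
    - move=> a u [c mc Nu]; exists (a * c); first exact: is_idealM.
      by rewrite -mulrA -mulrBr; exact: is_idealM.
  have [d dc] := local_ring_unit1B mc.
  rewrite -(mul1r y) -dc -mulrA mulrBl mul1r; exact: is_idealM.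
(* The chosen [x] is absorbed into the base ideal, and the remaining generators are exchanged modulo
   it. *)
have [|//|||t [ts tA At]] := IHs (adjoin x N).
- exact: is_ideal_adjoin.
- by move=> z zs; apply: sA; rewrite inE zs orbT.
- by apply: subset_trans AxN1 _; exact: adjoins_adjoin.
exists (x :: t); split; first by rewrite /= ts.
  by move=> z; rewrite inE => /orP[/eqP ->|/tA].
by apply: subset_trans At _; exact: adjoinsC.
Qed.

End LocalRing.

(** * Leading exponents with respect to generators of the maximal ideal *)

Section LeadingExponents.
Variables (R : comPzRingType) (m : set R) (g : seq R).
Local Open Scope classical_set_scope.
Hypotheses (m_local : local_ring m) (m_span : m = ideal_span [set` g]).
Let d := size g.
Let mi : is_ideal m := local_ring_ideal m_local.
Let mpi n : is_ideal (ideal_pow m n) := ideal_pow_ideal m n.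
Implicit Types (a b c : seq nat) (s n k : nat).

Definition monom b : R := \prod_(p <- zip g b) p.1 ^+ p.2.

Lemma monom_add b c : size b = d -> size c = d ->
  monom (exp_add b c) = monom b * monom c.
Proof.
rewrite /monom /d; elim: g b c => [|x h IHh] [|i b] [|j c] //=.
  by rewrite !big_nil mulr1.
by move=> [bd] [cd]; rewrite !big_cons /= IHh // exprD mulrACA.
Qed.

Lemma monom_pow b : size b = d -> ideal_pow m (sumn b) (monom b).
Proof.
have gm : {in g, forall x, m x} by move=> x xg; rewrite m_span; exact: ideal_span_mem.
rewrite /monom /d; elim: (g) b gm => [|x h IHh] [|i b] //= gm [bd].
rewrite big_cons; apply: ideal_powM.
  by apply: ideal_pow_exp; apply: gm; rewrite mem_head.
by apply: IHh => // y yh; apply: gm; rewrite inE yh orbT.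
Qed.

Lemma monom_gen x : x \in g -> exists b, [/\ size b = d, sumn b = 1%N & monom b = x].
Proof.
rewrite /monom /d; elim: (g) => //= y h IHh; rewrite inE => /orP[/eqP ->|/IHh].
  exists (1%N :: nseq (size h) 0%N); split; rewrite /= ?size_nseq ?sumn_nseq //.
  rewrite big_cons expr1; elim: h {IHh} => [|z h IHh]; first by rewrite big_nil mulr1.
  by rewrite big_cons expr0 mul1r.
move=> [b [bd bs bx]]; exists (0%N :: b); split; rewrite /= ?bd //.
by rewrite big_cons expr0 mul1r.
Qed.

Definition monoms s : set R := [set monom b | b in [set` exps d s]].

Lemma ideal_pow_monoms s : ideal_pow m s `<=` ideal_span (monoms s).
Proof.
elim: s => [|s IHs].
  move=> x _; rewrite -(mulr1 x); apply: (is_idealM x (ideal_span_ideal _)).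
  apply: ideal_span_mem; exists (nseq d 0%N).
    by rewrite /= mem_exps size_nseq sumn_nseq !eqxx.
  rewrite /monom /d; elim: (g) => [|y h IHh]; first by rewrite big_nil.
  by rewrite /= big_cons expr0 mul1r.
apply: ideal_span_sub; first exact: ideal_span_ideal.
move=> _ [x mx [y /IHs my <-]]; rewrite m_span in mx.
apply: ideal_span_mul mx my; first exact: ideal_span_ideal.
move=> u v /= ug [b /=]; rewrite mem_exps => /andP[/eqP bd /eqP bs] <-.
have [c [cd cs <-]] := monom_gen ug.
apply: ideal_span_mem; exists (exp_add c b); last exact: monom_add.
by rewrite /= mem_exps size_exp_add ?sumn_exp_add ?cd ?bd ?cs ?bs ?eqxx.
Qed.

(** What comes after [monom b] when monomials are ordered by degree, ties being broken
    lexicographically. Including the whole next power of [m] discards all terms of higher degree. *)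
Definition monoms_gt b : set R := ideal_span
  ([set monom c | c in [set c | c \in exps d (sumn b) /\ (b < c)%O]] `|`
   ideal_pow m (sumn b).+1).

(* Modulo higher degree, some element of [I] is a form whose
   lexicographically smallest monomial is [monom b]. *)
Definition leading (I : set R) b : Prop :=
  exists2 z, I z & monoms_gt b (z - monom b).

Lemma leading_sub I J b : I `<=` J -> leading I b -> leading J b.
Proof. by move=> IJ [z /IJ Jz ?]; exists z. Qed.

Lemma monoms_gt_mul b c z : size b = d -> size c = d ->
  monoms_gt b z -> monoms_gt (exp_add c b) (monom c * z).
Proof.
move=> bd cd; have cb : size c = size b by rewrite bd.
apply: (@ideal_span_sub _ [set z | monoms_gt (exp_add c b) (monom c * z)]).
  by apply: is_ideal_colon; exact: ideal_span_ideal.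
move=> y [[e [/=]]|my].
  rewrite mem_exps => /andP[/eqP ed /eqP es] be <-.
  rewrite -monom_add //; apply: ideal_span_mem; left.
  exists (exp_add c e) => //; split.
    by rewrite mem_exps size_exp_add ?sumn_exp_add ?cd ?ed ?es ?eqxx.
  by apply: exp_addr_lt => //; rewrite ?bd ?ed ?cd.
apply: ideal_span_mem; right.
by rewrite sumn_exp_add // -addnS; apply: ideal_powM => //; exact: monom_pow.
Qed.

Lemma leading_add I b c : is_ideal I -> size b = d -> size c = d ->
  leading I b -> leading I (exp_add c b).
Proof.
move=> Ii bd cd [z Iz zb]; exists (monom c * z); first exact: is_idealM.
by rewrite monom_add // -mulrBr; exact: monoms_gt_mul.
Qed.

(* Successive elimination of the smallest monomial, in increasing degree. *)
Lemma sub_of_leading I J n : is_ideal I -> is_ideal J -> ideal_pow m n `<=` J ->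
  (forall b, size b = d -> (sumn b < n)%N -> leading I b -> leading (I `&` J) b) ->
  I `<=` J.
Proof.
move=> Ii Ji mJ IJ.
(* Induction on the number [e] of degrees remaining below [n]; the case [e = 0] is the inclusion of
   the [n]-th power of [m] in [J]. *)
suff H e s : (s + e = n)%N -> I `&` ideal_pow m s `<=` J.
  by move=> z Iz; apply: (H n 0%N).
elim: e s => [|e IHe] s; first by rewrite addn0 => -> z [_ /mJ].
rewrite addnS -addSn => sn; have {}IHe := IHe _ sn.
(* [M] lists the exponents of degree [s] increasingly. The elimination shortens a final segment [D]
   of [M] until [tail D] is reduced to the power [s.+1] of [m]. *)
pose M := sort (@Order.le _ (seq nat)) (undup (exps d s)).
have M_sorted : pairwise (@Order.lt _ (seq nat)) M.
  by rewrite -sorted_pairwise ?sort_lt_sorted ?undup_uniq //; exact: lt_trans.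
have memM b : (b \in M) = (b \in exps d s) by rewrite mem_sort mem_undup.
pose tail D := foldr (@adjoin R) (ideal_pow m s.+1) (map monom D).
have taili D : is_ideal (tail D) by exact: is_ideal_adjoins.
suff H P D : P ++ D = M -> I `&` tail D `<=` J.
  move=> z [Iz mz]; apply: (H [::] M) => //; split=> //.
  apply: ideal_span_sub (ideal_pow_monoms mz) => // _ [b /= bM <-].
  by apply: adjoins_mem => //; apply: map_f; rewrite memM.
elim: D P => [|b D IHD] P PD //.
have {}IHD : I `&` tail D `<=` J by apply: (IHD (rcons P b)); rewrite cat_rcons.
have : b \in M by rewrite -PD mem_cat mem_head orbT.
rewrite memM mem_exps => /andP[/eqP bd /eqP bs].
have gtE : monoms_gt b = tail D.
  apply/seteqP; split.
    apply: ideal_span_sub => // y [[c [/=]]|my]; last first.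
      by apply: sub_adjoins; rewrite -bs.
    rewrite bs -memM -PD mem_cat => cM bc <-.
    apply: adjoins_mem => //; apply: map_f.
    move: M_sorted; rewrite -PD pairwise_cat => /and3P[/allrelP PbD _ _].
    case/orP: cM => [cP|].
      by have := lt_trans bc (PbD c b cP (mem_head _ _)); rewrite ltxx.
    by rewrite inE => /orP[/eqP cb|//]; rewrite cb ltxx in bc.
  apply: adjoins_sub; first exact: ideal_span_ideal.
    by move=> z mz; apply: ideal_span_mem; right; rewrite bs.
  move=> _ /mapP[c cD ->]; apply: ideal_span_mem; left; exists c => //; split.
    by rewrite bs -memM -PD mem_cat inE cD !orbT.
  move: M_sorted; rewrite -PD pairwise_cat /= => /and3P[_ _].
  by move=> /andP[/allP bD _]; exact: bD.
move=> z [Iz [c zc]].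
(* A coefficient in [m] pushes the term into degree [s.+1]. Otherwise it is a unit, [b] is a leading
   exponent of [I], and a multiple of some [y] in both [I] and [J] cancels the term. *)
have [mc|mc] := pselect (m c).
  apply: IHD; split=> //; rewrite -(subrK (c * monom b) z).
  apply: is_idealD => //; apply: sub_adjoins.
  rewrite -bs -add1n; apply: ideal_powM; first exact: ideal_pow1.
  exact: monom_pow.
have [u uc] := local_ring_unit m_local mc.
have [|||y [Iy Jy] yb] := IJ b => //; first by rewrite bs -sn leq_addr.
  exists (u * z); first exact: is_idealM.
  have -> : u * z - monom b = u * (z - c * monom b).
    by rewrite mulrBr mulrA uc mul1r.
  by rewrite gtE; exact: is_idealM.
rewrite -(subrK (c * y) z); apply: is_idealD => //; last exact: is_idealM.
apply: IHD; split; first by apply: is_idealB => //; exact: is_idealM.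
have -> : z - c * y = (z - c * monom b) - c * (y - monom b).
  by rewrite mulrBr opprB addrA subrK.
by apply: is_idealB => //; apply: is_idealM => //; rewrite -gtE.
Qed.

Variable J : nat -> set R.
Hypotheses (Ji : forall k, is_ideal (J k))
  (Jdec : forall k l, (k <= l)%N -> J l `<=` J k).

(** Only finitely many exponents have degree below [n], and the sets of leading exponents decrease
    with [k]. *)
Lemma leading_stable n : exists K, forall k, (K <= k)%N ->
  forall b, size b = d -> (sumn b < n)%N -> leading (J k) b ->
  forall l, leading (J l) b.
Proof.
have [|K HK] := @eventually_stable _ (flatten [seq exps d s | s <- iota 0 n])
  (fun k => leading (J k)).
  by move=> k l b kl; apply: leading_sub; exact: Jdec.
exists K => k Kk b bd bn; apply: HK => //; apply/flatten_mapP.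
by exists (sumn b); rewrite ?mem_iota // mem_exps bd !eqxx.
Qed.

(** Once the leading exponents below degree [n] are stationary, those of [J k] also occur in [J l],
    and elimination turns this into an inclusion modulo the [n]-th power. *)
Lemma chain_stable n : exists K, forall k, (K <= k)%N -> forall l,
  J k `<=` ideal_add (J l) (ideal_pow m n).
Proof.
have [K HK] := leading_stable n; exists K => k Kk l.
have [lk|/ltnW kl] := leqP l k.
  move=> z /(Jdec lk) Jz; exists z => //; rewrite subrr; exact: is_ideal0.
apply: (@sub_of_leading _ _ n) => //; first exact: is_ideal_add.
  by move=> z mz; exists 0; rewrite ?subr0 //; exact: is_ideal0.
move=> b bd bn /(HK k Kk b bd bn)/(_ l); apply: leading_sub => z Jz.
split; first exact: Jdec kl _ Jz.
by exists z => //; rewrite subrr; exact: is_ideal0.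
Qed.

(* The bound [r] stands for the number of generators of the ideal of the
   completion which is the limit of the chain [J]. *)
Lemma chain_generators : exists r, forall n, exists K, forall k, (K <= k)%N ->
  exists t, [/\ size t = r, forall x, x \in t -> J k x &
    J k `<=` foldr (@adjoin R) (ideal_pow m n) t].
Proof.
(* The exponents leading for every [J k] do not depend on [n], and neither does the size of their
   basis [B]: this gives the uniform [r]. *)
have [B BU BP] := dickson d [set b | forall k, leading (J k) b].
exists (size B) => n; have [K HK] := leading_stable n.
exists K => k Kk.
have /choice[z zP] b : exists z, b \in B -> J k z /\ monoms_gt b (z - monom b).
  case: (boolP (b \in B)) => [bB|_]; last by exists 0.
  by have [/(_ k)[z] ? ? _] := BU b bB; exists z.
exists (map z B); split; first by rewrite size_map.
  by move=> _ /mapP[b bB ->]; have [] := zP b bB.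
set T := foldr _ _ _; have Ti : is_ideal T by exact: is_ideal_adjoins.
apply: (@sub_of_leading _ _ n) => //; first exact: sub_adjoins.
(* Past [K], a leading exponent below degree [n] is leading for the whole chain, hence a translate
   of one in [B]. *)
move=> a ad an /(HK k Kk a ad an) aU.
have [b bB [c cd ->]] := BP a aU ad; have [_ bd] := BU b bB.
apply: leading_add => //; first exact: is_ideal_setI.
have [Jz zb] := zP b bB; exists (z b) => //; split=> //.
by apply: adjoins_mem => //; exact: map_f.
Qed.

End LeadingExponents.

(** * Nilpotents of the completion in terms of Cauchy sequences *)

Section Completion.
Variables (R : comPzRingType) (I : set R).
Local Open Scope quotient_scope.
Implicit Types u : cauchy_seq I.

Lemma pi_completionX u n :
  \pi_(completion I) (u ^+ n) = \pi_(completion I) u ^+ n.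
Proof.
elim: n => [|n IHn]; last by rewrite !exprS pi_completion_mul IHn.
by rewrite !expr0 [1 in RHS]piE.
Qed.

Lemma pi_completion_eq0 u :
  \pi_(completion I) u = 0 <-> u \in @adic_null R I.
Proof.
have -> : (0 : completion I) = \pi_(completion I) 0 by rewrite piE.
by split=> [/eqP|u0]; last apply/eqP; rewrite piE Quotient.equivE subr0.
Qed.

Lemma val_cauchy_seqX u n i : val (u ^+ n) i = val u i ^+ n.
Proof.
elim: n => [|n IHn]; first by rewrite !expr0 rmorph1.
by rewrite !exprS rmorphM /= -IHn.
Qed.

Lemma completion_reducedP : reduced (completion I) <->
  forall u n, u ^+ n \in @adic_null R I -> u \in @adic_null R I.
Proof.
split=> [red u n|null x n].
  rewrite -!pi_completion_eq0 pi_completionX; exact: red.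
rewrite -[x]reprK -pi_completionX !pi_completion_eq0; exact: null.
Qed.

End Completion.

(** * From a reduced completion to a bound on orders of squares *)

Section SquareOrder.
Variables (R : comPzRingType) (m : set R).
Local Open Scope classical_set_scope.
Hypotheses (R_noeth : noetherian R) (m_local : local_ring m).
Let mpi n : is_ideal (ideal_pow m n) := ideal_pow_ideal m n.

Let A k : set R := [set x | ideal_pow m k (x ^+ 2)].
Let J k : set R := ideal_span (A k).

Lemma square_chain_dec k l : (k <= l)%N -> J l `<=` J k.
Proof.
move=> kl; apply: ideal_span_sub; first exact: ideal_span_ideal.
by move=> x /= /(ideal_pow_le kl) xk; exact: ideal_span_mem.
Qed.

Lemma square_chain_nilpotent : exists r, forall n, exists K,
  forall k, (K <= k)%N -> forall z, J k z -> ideal_pow m n (z ^+ r).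
Proof.
have [s ms] := R_noeth (local_ring_ideal m_local).
have [r rP] := chain_generators m_local ms
  (fun k => ideal_span_ideal (A k)) square_chain_dec.
(* One more than the number of generators, for the pigeonhole. Taking [k] at least [n] puts the
   squares of elements of [A k] in the [n]-th power. *)
exists r.+1 => n; have [K KP] := rP n.
exists (maxn K n) => k; rewrite geq_max => /andP[/KP[t [tr tJ Jt]] nk] z Jz.
have [|t' [t'r t'A Jt']] := adjoins_exchange m_local (mpi n) _ tJ Jt.
  by rewrite /A /= expr2 mul0r; exact: is_ideal0.
rewrite -tr -t'r; apply: adjoins_expr => //; last exact: Jt'.
by move=> x /t'A; exact: ideal_pow_le.
Qed.

Lemma square_order_bound : reduced (completion m) ->
  forall n, exists k, forall x, ideal_pow m k (x ^+ 2) -> ideal_pow m n x.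
Proof.
move=> /completion_reducedP red n; apply: contrapT => /forallNP unbounded.
have [s ms] := R_noeth (local_ring_ideal m_local).
have [r rP] := square_chain_nilpotent.
(* [K i] serves both the nilpotence bound and stationarity modulo the [i]-th power. *)
have /choice[K KP] i : exists K,
    (forall z, J K z -> ideal_pow m i (z ^+ r)) /\
    (forall l, J K `<=` ideal_add (J l) (ideal_pow m i)).
  have [K1 h1] := rP i.
  have [K2 h2] := chain_stable m_local ms
    (fun k => ideal_span_ideal (A k)) square_chain_dec i.
  by exists (maxn K1 K2); split=> [z|l]; [apply: h1|apply: h2]; lia.
(* A single correction, from one ideal of the chain to the next; outside the first ideal the value
   [0] is arbitrary. *)
have /choice[f fP] (p : nat * R) : exists z, J (K p.1) p.2 ->
    J (K p.1.+1) z /\ ideal_pow m p.1 (p.2 - z).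
  have [Jp|//] := pselect (J (K p.1) p.2); last by exists 0.
  by have [_ /(_ (K p.1.+1) _ Jp)[z ? ?]] := KP p.1; exists z.
have /existsNP[x0 /not_implyP[x0K x0n]] := unbounded (K n).
(* Starting the corrections at level [n] keeps every [u i] congruent to [x0] modulo the [n]-th
   power, so [u] cannot tend to [0]. *)
pose u := fix u i := if i is i'.+1 then f ((n + i')%N, u i') else x0.
have uJ i : J (K (n + i)%N) (u i).
  elim: i => [|i /(fP (_, _))[]]; first by rewrite addn0; exact: ideal_span_mem.
  by rewrite addnS.
have u_step i : ideal_pow m (n + i) (u i - u i.+1).
  by have [] := fP ((n + i)%N, u i) (uJ i).
have u_close i j : (i <= j)%N -> ideal_pow m (n + i) (u i - u j).
  move=> /subnKC <-; elim: (j - i)%N => [|e IHe].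
    by rewrite addn0 subrr; exact: is_ideal0.
  rewrite -(subrKA (u (i + e)%N)); apply: is_idealD => //.
  by rewrite addnS; apply: ideal_pow_le (u_step (i + e)%N); lia.
have u_cauchy : adic_cauchy m u.
  apply/asboolP => l; exists l => i j li lj.
  rewrite -(subrKA (u l)) -(opprB (u l) (u i)); apply: (@ideal_pow_le _ _ _ (n + l)).
    exact: leq_addl.
  by apply: is_idealD => //; [apply: is_idealN => //|]; exact: u_close.
(* As [u i] lies in [J (K (n + i))], its [r]-th power lies in the power [n + i] of [m]; reducedness
   then forces [u] to be null. *)
have /asboolP/(_ n)[N uN] : (exist _ u u_cauchy : cauchy_seq m) \in @adic_null R m.
  apply: (red _ r); apply/asboolP => l; exists l => i li.
  rewrite val_cauchy_seqX /=; have [+ _] := KP (n + i)%N.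
  by move=> /(_ _ (uJ i)); apply: ideal_pow_le; lia.
apply: x0n; rewrite -(subrK (u N) x0); apply: is_idealD => //; last exact: uN.
by have := u_close 0%N N (leq0n _); rewrite addn0.
Qed.

End SquareOrder.

(** * Back from a bound on squares to reducedness, and the equivalence *)

Lemma reduced_of_square_order (R : comPzRingType) (I : set R) :
  (forall n, exists k, forall x, ideal_pow I k (x ^+ 2) -> ideal_pow I n x) ->
  reduced (completion I).
Proof.
move=> bound; apply/completion_reducedP.
have sq (u : cauchy_seq I) : u ^+ 2 \in @adic_null R I -> u \in @adic_null R I.
  move=> /asboolP u2; apply/asboolP => n.
  have [k kP] := bound n; have [N uN] := u2 k.
  by exists N => i /uN; rewrite val_cauchy_seqX => /kP.
(* Since [n <= 2 ^ n], the power [2 ^ n] is null as well, and [sq] removes one squaring at a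
   time. *)
move=> u n un; have : u ^+ (2 ^ n) \in @adic_null R I.
  rewrite -(subnK (ltnW (ltn_expl n (ltnSn 1)))) exprD; exact: adic_null_mull.
elim: n {un} => [|n IHn]; first by rewrite expr1.
by rewrite expnS mulnC exprM => /sq.
Qed.

Theorem corollary12p9 (R : comNzRingType) (m : set R)
    (R_noeth : noetherian R) (R_local : local_ring m) :
  analytically_unramified m <->
  exists nu : natbar -> natbar, numerical_function nu /\
    forall x : R, (ord m (x ^+ 2) <= nu (ord m x))%O.
Proof.
split=> [red|[nu [[nu_homo nu_infty] nuP]]].
  have /choice[K KP] := square_order_bound R_noeth R_local red.
  (* The maximum makes [h] non-decreasing. The shift to [i.+1] gives the contradiction: if [x] has
     order [n] and its square has order at least [K n.+1], then [x] has order at least [n.+1]. *)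
  pose h n := (\max_(i < n.+1) K i.+1)%N.
  exists (fun s => if s is Fin n then Fin (h n) else Infty); split.
    split=> [[a|] [b|] //|[a|] //].
    rewrite -[(Fin a <= Fin b)%O]/(a <= b)%N -[(_ <= _)%O]/(h a <= h b)%N => ab.
    apply/bigmax_leqP => i _.
    exact: (leq_bigmax (widen_ord (ab : a.+1 <= b.+1)%N i)).
  move=> x; case E: (ord m x) => [n|]; last by case: (ord _ _).
  rewrite leNgt; apply/negP => lt.
  suff : (Fin n.+1 <= ord m x)%O by rewrite E -[(_ <= _)%O]/(n.+1 <= n)%N ltnn.
  apply/le_ord/KP/le_ord; apply: le_trans (ltW lt).
  exact: (leq_bigmax (ord_max : 'I_n.+1)).
(* The zeroth power is everything. For [n.+1], the value [k] of [nu] at [n] is finite and [k.+1]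
   works: an [x] of order at most [n] has a square of order at most [k]. *)
apply: reduced_of_square_order => -[|n]; first by exists 0%N.
case E : (nu (Fin n)) => [k|]; last by have /nu_infty := E.
exists k.+1 => x /le_ord xk; apply/le_ord; rewrite leNgt; apply/negP => lt.
have xn : (ord m x <= Fin n)%O.
  by case: (ord m x) lt => [a|//]; rewrite ltNge -[(_ <= _)%O]/(n.+1 <= a)%N -ltnNge.
have := le_trans xk (le_trans (nuP x) (nu_homo _ _ xn)).
by rewrite E -[(_ <= _)%O]/(k.+1 <= k)%N ltnn.
Qed.
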